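(* Let $(\mathcal A,\mathcal B,\mathcal C)$ be a recollement of extriangulated categories, with functors $i^*,i_*,i^!,j_!,j^*,j_*$. Assume that $\mathcal B$ has enough projectives and that $i^!$ and $j_!$ are exact. Let $(\mathcal U_1,\mathcal V_1)$ and $(\mathcal U_3,\mathcal V_3)$ be cotorsion pairs in $\mathcal A$ and $\mathcal C$, respectively. Define $$\widetilde{\mathcal U_2}=\{B\in\mathcal B\mid i^*B\in\mathcal U_1\text{ and }j^*B\in\mathcal U_3\},\qquad \mathcal V_2=\{B\in\mathcal B\mid i^!B\in\mathcal V_1\text{ and }j^*B\in\mathcal V_3\},$$ and $\mathcal U_2:={}^{\bot_1}\mathcal V_2=\{X\in\mathcal B\mid \mathbb E_{\mathcal B}(X,V)=0\ \text{for all } V\in\mathcal V_2\}$. Then $(\mathcal U_2,\mathcal V_2)$ is a cotorsion pair in $\mathcal B$, and $\mathcal U_2\subseteq \mathrm{add}\,\widetilde{\mathcal U_2}$.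
   Context: Extriangulated categories $(\mathcal E,\mathbb E_{\mathcal E},\mathfrak s_{\mathcal E})$ are in the sense of Nakaoka–Palu. Standing assumptions: all extriangulated categories are $k$-linear over a field $k$, Hom-finite, Krull–Schmidt, and satisfy Condition (WIC): if a composite $gf$ is a deflation then $g$ is a deflation; if $gf$ is an inflation then $f$ is an inflation. A subcategory means a full subcategory closed under isomorphisms, finite direct sums and direct summands. For a class of objects $\mathcal X$, $\mathrm{add}\,\mathcal X$ is the class of direct summands of finite direct sums of objects of $\mathcal X$. Exact notions. A morphism is compatible if it is an isomorphism whenever it is both an inflation and a deflation. A sequence $A\xrightarrow{f}B\xrightarrow{g}C$ is right exact if there is an $\mathbb E$-triangle $K\xrightarrow{h_2}B\xrightarrow{g}C\dashrightarrow$ and a compatible deflation $h_1:A\to K$ with $f=h_2h_1$; it is left exact if there is an $\mathbb E$-triangle $A\xrightarrow{f}B\xrightarrow{h_1}K\dashrightarrow$ and a compatible inflation $h_2:K\to C$ with $g=h_2h_1$. A sequence $A\xrightarrow{f}B\xrightarrow{g}C\xrightarrow{h}D$ is a right exact (resp. left exact) $\mathbb E$-triangle sequence if there are $\mathbb E$-triangles $A\xrightarrow{f}B\xrightarrow{g_1}K\dashrightarrow$ and $K\xrightarrow{g_2}C\xrightarrow{h}D\dashrightarrow$ with $g=g_2g_1$ and $g_1$ (resp. $g_2$) compatible. An additive functor is right (resp. left) exact if it preserves compatible morphisms and right (resp. left) exact sequences. An additive functor $F$ is exact if for every $\mathbb E$-triangle $A\xrightarrow{f}B\xrightarrow{g}C\dashrightarrow$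 the sequence $FA\xrightarrow{Ff}FB\xrightarrow{Fg}FC$ is an $\mathbb E$-triangle. Recollement. A recollement $(\mathcal A,\mathcal B,\mathcal C)$ of extriangulated categories consists of exact functors $i_*:\mathcal A\to\mathcal B$, $j^*:\mathcal B\to\mathcal C$, right exact functors $i^*:\mathcal B\to\mathcal A$, $j_!:\mathcal C\to\mathcal B$ and left exact functors $i^!:\mathcal B\to\mathcal A$, $j_*:\mathcal C\to\mathcal B$ such that: (R1) $(i^*,i_*,i^!)$ and $(j_!,j^*,j_* )$ are adjoint triples; (R2) $\mathrm{Im}\, i_*=\mathrm{Ker}\, j^*$; (R3) $i_*,j_!,j_*$ are fully faithful; (R4) for each $X\in\mathcal B$ there is a left exact $\mathbb E_{\mathcal B}$-triangle sequence $i_*i^!X\to X\to j_*j^*X\to i_*A$ with $A\in\mathcal A$, the first two maps being the adjunction morphisms; (R5) for each $X\in\mathcal B$ there is a right exact $\mathbb E_{\mathcal B}$-triangle sequence $i_*A'\to j_!j^*X\to X\to i_*i^*X$ with $A'\in\mathcal A$, the last two maps being the adjunction morphisms. Cotorsion pair. A pair $(\mathcal U,\mathcal V)$ of subcategories of $\mathcal E$ is a cotorsion pair if $\mathbb E_{\mathcal E}(\mathcal U,\mathcal V)=0$ and every $B\in\mathcal E$ admits $\mathbb E_{\mathcal E}$-triangles $V_B\to U_B\to B\dashrightarrow$ and $B\to V^B\to U^B\dashrightarrow$ with $U_B,U^B\in\mathcal U$, $V_B,V^B\in\mathcal V$. *)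

(* Defs.v *)
From mathcomp Require Import all_boot all_algebra.

Set Implicit Arguments.
Unset Strict Implicit.
Unset Printing Implicit Defensive.

Import GRing.Theory.
Local Open Scope ring_scope.

Reserved Notation "g \oc f" (at level 40, left associativity).

(* Hom-finiteness is built into the types: a [vectType k] is a
   finite-dimensional vector space over [k]. *)
Record lincat (k : fieldType) := LinCat {
  Ob :> Type;
  Mor : Ob -> Ob -> vectType k;
  idm : forall X, Mor X X;
  compm : forall X Y Z, Mor Y Z -> Mor X Y -> Mor X Z;
  comp1m : forall X Y (f : Mor X Y), compm (idm Y) f = f;
  compm1 : forall X Y (f : Mor X Y), compm f (idm X) = f;
  compA : forall X Y Z W (h : Mor Z W) (g : Mor Y Z) (f : Mor X Y),
    compm h (compm g f) = compm (compm h g) f;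
  comp_linearl : forall X Y Z (a : k) (g g' : Mor Y Z) (f : Mor X Y),
    compm (a *: g + g') f = a *: compm g f + compm g' f;
  comp_linearr : forall X Y Z (a : k) (g : Mor Y Z) (f f' : Mor X Y),
    compm g (a *: f + f') = a *: compm g f + compm g f'
}.

Arguments Mor {k l} X Y.
Arguments idm {k l} X.
Arguments compm {k l X Y Z} g f.

Notation "g \oc f" := (compm g f).

Section LinCat.
Variables (k : fieldType) (C : lincat k).

Definition is_iso (X Y : C) (f : Mor X Y) : Prop :=
  exists g : Mor Y X, g \oc f = idm X /\ f \oc g = idm Y.

Definition isomorphic (X Y : C) : Prop := exists f : Mor X Y, is_iso f.

Definition is_zero (Z : C) : Prop :=
  forall X : C, (forall f : Mor X Z, f = 0) /\ (forall f : Mor Z X, f = 0).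

(* [S] together with these injections and projections is the direct sum of
   [A] and [B]. *)
Record is_biprod (A B S : C) (iA : Mor A S) (iB : Mor B S)
    (pA : Mor S A) (pB : Mor S B) : Prop := IsBiprod {
  biprod_pAiA : pA \oc iA = idm A;
  biprod_pBiB : pB \oc iB = idm B;
  biprod_pAiB : pA \oc iB = 0;
  biprod_pBiA : pB \oc iA = 0;
  biprod_sum : iA \oc pA + iB \oc pB = idm S
}.

Definition dsum (A B S : C) : Prop :=
  exists iA iB pA pB, @is_biprod A B S iA iB pA pB.

Definition is_additive : Prop :=
  (exists Z : C, is_zero Z) /\ (forall A B : C, exists S : C, dsum A B S).

Definition summand (Y S : C) : Prop := exists Y' : C, dsum Y Y' S.

(* [fin_sum X S]: [S] is a finite (possibly empty) direct sum of objects
   of [X]. *)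
Inductive fin_sum (X : C -> Prop) : C -> Prop :=
| fin_sum0 Z : is_zero Z -> fin_sum X Z
| fin_sumS A B S : X A -> fin_sum X B -> dsum A B S -> fin_sum X S.

Definition add_closure (X : C -> Prop) (Y : C) : Prop :=
  exists S : C, fin_sum X S /\ summand Y S.

(* The endomorphism ring of [X] is local: it is nonzero and its nonunits are
   closed under addition. *)
Definition local_End (X : C) : Prop :=
  idm X <> 0 /\
  forall f g : Mor X X, is_iso (f + g) -> is_iso f \/ is_iso g.

Definition krull_schmidt : Prop := forall X : C, fin_sum local_End X.

Record is_subcat (X : C -> Prop) : Prop := IsSubcat {
  subcat_iso : forall A B, X A -> isomorphic A B -> X B;
  subcat_zero : forall Z, is_zero Z -> X Z;
  subcat_dsum : forall A B S, X A -> X B -> dsum A B S -> X S;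
  subcat_summand : forall A S, X S -> summand A S -> X A
}.

End LinCat.

(* [Ext C A] is E(C, A); [push a d] is E(C, a)(d) and [pull c d] is E(c, A)(d).
   The realization s is encoded by the relation
   [realizes x y d], meaning s(d) = [A -x-> B -y-> C]. *)
Record extdata (k : fieldType) := ExtData {
  ed_cat :> lincat k;
  Ext : ed_cat -> ed_cat -> lmodType k;
  push : forall C A A', Mor A A' -> Ext C A -> Ext C A';
  pull : forall C C' A, Mor C' C -> Ext C A -> Ext C' A;
  realizes : forall A B C, Mor A B -> Mor B C -> Ext C A -> Prop
}.

Arguments Ext {k e} C A.
Arguments push {k e C A A'} a d.
Arguments pull {k e C C' A} c d.
Arguments realizes {k e A B C} x y d.

Section ExtLaws.
Variables (k : fieldType) (E : extdata k).

(* (ET1), in its k-linear form *)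
Record bilinear_bifunctor : Prop := BilinearBifunctor {
  push1 : forall (C A : E) (d : Ext C A), push (idm A) d = d;
  pushM : forall (C A A' A'' : E) (a' : Mor A' A'') (a : Mor A A')
    (d : Ext C A), push (a' \oc a) d = push a' (push a d);
  pull1 : forall (C A : E) (d : Ext C A), pull (idm C) d = d;
  pullM : forall (C C' C'' A : E) (c : Mor C' C) (c' : Mor C'' C')
    (d : Ext C A), pull (c \oc c') d = pull c' (pull c d);
  push_pull : forall (C C' A A' : E) (a : Mor A A') (c : Mor C' C)
    (d : Ext C A), push a (pull c d) = pull c (push a d);
  push_linearl : forall (C A A' : E) (l : k) (a a' : Mor A A') (d : Ext C A),
    push (l *: a + a') d = l *: push a d + push a' d;
  push_linearr : forall (C A A' : E) (l : k) (a : Mor A A') (d d' : Ext C A),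
    push a (l *: d + d') = l *: push a d + push a d';
  pull_linearl : forall (C C' A : E) (l : k) (c c' : Mor C' C) (d : Ext C A),
    pull (l *: c + c') d = l *: pull c d + pull c' d;
  pull_linearr : forall (C C' A : E) (l : k) (c : Mor C' C) (d d' : Ext C A),
    pull c (l *: d + d') = l *: pull c d + pull c d'
}.

Definition ext_morph (A C A' C' : E) (d : Ext C A) (d' : Ext C' A')
    (a : Mor A A') (c : Mor C C') : Prop :=
  push a d = pull c d'.

(* equivalence of sequences A -> B -> C and A -> B' -> C *)
Definition seq_equiv (A B B' C : E) (x : Mor A B) (y : Mor B C)
    (x' : Mor A B') (y' : Mor B' C) : Prop :=
  exists b : Mor B B', [/\ is_iso b, b \oc x = x' & y' \oc b = y].

(* The first three clauses say that [realizes] is the graph of a map from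
   extensions to equivalence classes of sequences. *)
Record is_realization : Prop := IsRealization {
  realizes_ex : forall (C A : E) (d : Ext C A),
    exists (B : E) (x : Mor A B) (y : Mor B C), realizes x y d;
  realizes_uniq : forall (A B B' C : E) (x : Mor A B) (y : Mor B C)
      (x' : Mor A B') (y' : Mor B' C) (d : Ext C A),
    realizes x y d -> realizes x' y' d -> seq_equiv x y x' y';
  realizes_equiv : forall (A B B' C : E) (x : Mor A B) (y : Mor B C)
      (x' : Mor A B') (y' : Mor B' C) (d : Ext C A),
    realizes x y d -> seq_equiv x y x' y' -> realizes x' y' d;
  realizes_morph : forall (A B C A' B' C' : E)
      (x : Mor A B) (y : Mor B C) (d : Ext C A)
      (x' : Mor A' B') (y' : Mor B' C') (d' : Ext C' A')
      (a : Mor A A') (c : Mor C C'),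
    realizes x y d -> realizes x' y' d' -> ext_morph d d' a c ->
    exists b : Mor B B', b \oc x = x' \oc a /\ y' \oc b = c \oc y
}.

(* (ET2).  In the second clause the direct sum of [d] and [d'] is the extension
   corresponding to (d, 0, 0, d') under
   E(C + C', A + A') = E(C, A) + E(C, A') + E(C', A) + E(C', A'). *)
Record additive_realization : Prop := AdditiveRealization {
  add_realization :> is_realization;
  realizes_split : forall (A C S : E) (iA : Mor A S) (iC : Mor C S)
      (pA : Mor S A) (pC : Mor S C),
    is_biprod iA iC pA pC -> realizes iA pC (0 : Ext C A);
  realizes_dsum : forall (A B C A' B' C' SA SB SC : E)
      (iA : Mor A SA) (iA' : Mor A' SA) (pA : Mor SA A) (pA' : Mor SA A')
      (iB : Mor B SB) (iB' : Mor B' SB) (pB : Mor SB B) (pB' : Mor SB B')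
      (iC : Mor C SC) (iC' : Mor C' SC) (pC : Mor SC C) (pC' : Mor SC C')
      (x : Mor A B) (y : Mor B C) (d : Ext C A)
      (x' : Mor A' B') (y' : Mor B' C') (d' : Ext C' A'),
    is_biprod iA iA' pA pA' -> is_biprod iB iB' pB pB' ->
    is_biprod iC iC' pC pC' ->
    realizes x y d -> realizes x' y' d' ->
    realizes (iB \oc x \oc pA + iB' \oc x' \oc pA')
             (iC \oc y \oc pB + iC' \oc y' \oc pB')
             (push iA (pull pC d) + push iA' (pull pC' d'))
}.

Definition ET3 : Prop :=
  forall (A B C A' B' C' : E)
      (x : Mor A B) (y : Mor B C) (d : Ext C A)
      (x' : Mor A' B') (y' : Mor B' C') (d' : Ext C' A')
      (a : Mor A A') (b : Mor B B'),
    realizes x y d -> realizes x' y' d' -> b \oc x = x' \oc a ->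
    exists c : Mor C C', c \oc y = y' \oc b /\ ext_morph d d' a c.

Definition ET3op : Prop :=
  forall (A B C A' B' C' : E)
      (x : Mor A B) (y : Mor B C) (d : Ext C A)
      (x' : Mor A' B') (y' : Mor B' C') (d' : Ext C' A')
      (b : Mor B B') (c : Mor C C'),
    realizes x y d -> realizes x' y' d' -> c \oc y = y' \oc b ->
    exists a : Mor A A', b \oc x = x' \oc a /\ ext_morph d d' a c.

(*   A --f--> B --f'--> D
     |        g         d'
     A --h--> C --h'--> G
              g'        e
              F ======= F     *)
Definition ET4 : Prop :=
  forall (A B C D F : E)
      (f : Mor A B) (f' : Mor B D) (d : Ext D A)
      (g : Mor B C) (g' : Mor C F) (d1 : Ext F B),
    realizes f f' d -> realizes g g' d1 ->
    exists (G : E) (h : Mor A C) (h' : Mor C G) (d' : Mor D G) (e : Mor G F)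
           (d2 : Ext G A),
      [/\ h = g \oc f, h' \oc g = d' \oc f' & e \oc h' = g'] /\
      [/\ realizes h h' d2, realizes d' e (push f' d1),
          pull d' d2 = d & push f d2 = pull e d1].

(*   D --d'--> G --e--> F
     |         h'       g'
     D --f'--> A --f--> B
               h        g
               C ====== C     *)
Definition ET4op : Prop :=
  forall (A B C D F : E)
      (f' : Mor D A) (f : Mor A B) (d : Ext B D)
      (g' : Mor F B) (g : Mor B C) (d1 : Ext C F),
    realizes f' f d -> realizes g' g d1 ->
    exists (G : E) (d' : Mor D G) (e : Mor G F) (h' : Mor G A) (h : Mor A C)
           (d2 : Ext C G),
      [/\ h = g \oc f, h' \oc d' = f' & f \oc h' = g' \oc e] /\
      [/\ realizes h' h d2, realizes d' e (pull g' d),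
          d1 = push e d2 & push d' d = pull g d2].

End ExtLaws.

Record extricat (k : fieldType) := ExtriCat {
  et_data :> extdata k;
  et_additive : is_additive et_data;
  et1 : bilinear_bifunctor et_data;
  et2 : additive_realization et_data;
  et3 : ET3 et_data;
  et3op : ET3op et_data;
  et4 : ET4 et_data;
  et4op : ET4op et_data
}.

Section Extriangulated.
Variables (k : fieldType) (E : extricat k).

Definition triangle (A B C : E) (x : Mor A B) (y : Mor B C) : Prop :=
  exists d : Ext C A, realizes x y d.

Definition inflation (A B : E) (x : Mor A B) : Prop :=
  exists (C : E) (y : Mor B C), triangle x y.

Definition deflation (B C : E) (y : Mor B C) : Prop :=
  exists (A : E) (x : Mor A B), triangle x y.

Definition WIC : Prop :=
  (forall (A B C : E) (f : Mor A B) (g : Mor B C),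
     deflation (g \oc f) -> deflation g) /\
  (forall (A B C : E) (f : Mor A B) (g : Mor B C),
     inflation (g \oc f) -> inflation f).

Definition compatible (X Y : E) (f : Mor X Y) : Prop :=
  inflation f -> deflation f -> is_iso f.

Definition right_exact_seq (A B C : E) (f : Mor A B) (g : Mor B C) : Prop :=
  exists (K : E) (h2 : Mor K B) (h1 : Mor A K),
    [/\ triangle h2 g, deflation h1, compatible h1 & f = h2 \oc h1].

Definition left_exact_seq (A B C : E) (f : Mor A B) (g : Mor B C) : Prop :=
  exists (K : E) (h1 : Mor B K) (h2 : Mor K C),
    [/\ triangle f h1, inflation h2, compatible h2 & g = h2 \oc h1].

Definition right_exact_triseq (A B C D : E)
    (f : Mor A B) (g : Mor B C) (h : Mor C D) : Prop :=
  exists (K : E) (g1 : Mor B K) (g2 : Mor K C),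
    [/\ triangle f g1, triangle g2 h, g = g2 \oc g1 & compatible g1].

Definition left_exact_triseq (A B C D : E)
    (f : Mor A B) (g : Mor B C) (h : Mor C D) : Prop :=
  exists (K : E) (g1 : Mor B K) (g2 : Mor K C),
    [/\ triangle f g1, triangle g2 h, g = g2 \oc g1 & compatible g2].

Definition projective (P : E) : Prop :=
  forall (A B C : E) (x : Mor A B) (y : Mor B C), triangle x y ->
  forall c : Mor P C, exists b : Mor P B, y \oc b = c.

Definition enough_projectives : Prop :=
  forall C : E, exists (A P : E) (x : Mor A P) (y : Mor P C),
    projective P /\ triangle x y.

(* the left perpendicular class of V with respect to E(-, -) *)
Definition lperp1 (V : E -> Prop) (X : E) : Prop :=
  forall Y : E, V Y -> forall d : Ext X Y, d = 0.

Record cotorsion_pair (U V : E -> Prop) : Prop := CotorsionPair {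
  cot_subl : is_subcat U;
  cot_subr : is_subcat V;
  cot_ext : forall X Y : E, U X -> V Y -> forall d : Ext X Y, d = 0;
  cot_left : forall B : E, exists (VB UB : E) (x : Mor VB UB) (y : Mor UB B),
    [/\ U UB, V VB & triangle x y];
  cot_right : forall B : E, exists (VB UB : E) (x : Mor B VB) (y : Mor VB UB),
    [/\ U UB, V VB & triangle x y]
}.

End Extriangulated.

Definition standing (k : fieldType) (E : extricat k) : Prop :=
  krull_schmidt E /\ WIC E.

Record addfunctor (k : fieldType) (C D : lincat k) := AddFunctor {
  fobj :> C -> D;
  fmap : forall X Y : C, Mor X Y -> Mor (fobj X) (fobj Y);
  fmap1 : forall X : C, fmap (idm X) = idm (fobj X);
  fmapM : forall (X Y Z : C) (g : Mor Y Z) (f : Mor X Y),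
    fmap (g \oc f) = fmap g \oc fmap f;
  fmapD : forall (X Y : C) (f g : Mor X Y), fmap (f + g) = fmap f + fmap g
}.

Arguments fmap {k C D} F {X Y} f : rename.

Definition fully_faithful (k : fieldType) (C D : lincat k)
    (F : addfunctor C D) : Prop :=
  forall X Y : C, bijective (fun f : Mor X Y => fmap F f).

(* [F] is left adjoint to [G]. *)
Record adjunction (k : fieldType) (C D : lincat k)
    (F : addfunctor C D) (G : addfunctor D C) := Adjunction {
  adj_unit : forall X : C, Mor X (G (F X));
  adj_counit : forall Y : D, Mor (F (G Y)) Y;
  unit_nat : forall (X X' : C) (f : Mor X X'),
    adj_unit X' \oc f = fmap G (fmap F f) \oc adj_unit X;
  counit_nat : forall (Y Y' : D) (g : Mor Y Y'),
    adj_counit Y' \oc fmap F (fmap G g) = g \oc adj_counit Y;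
  adj_triangleL : forall X : C, adj_counit (F X) \oc fmap F (adj_unit X) = idm (F X);
  adj_triangleR : forall Y : D, fmap G (adj_counit Y) \oc adj_unit (G Y) = idm (G Y)
}.

Section Exactness.
Variables (k : fieldType) (C D : extricat k) (F : addfunctor C D).

Definition exact_functor : Prop :=
  forall (X Y Z : C) (f : Mor X Y) (g : Mor Y Z),
    triangle f g -> triangle (fmap F f) (fmap F g).

Definition preserves_compatible : Prop :=
  forall (X Y : C) (f : Mor X Y), compatible f -> compatible (fmap F f).

Definition right_exact_functor : Prop :=
  preserves_compatible /\
  forall (X Y Z : C) (f : Mor X Y) (g : Mor Y Z),
    right_exact_seq f g -> right_exact_seq (fmap F f) (fmap F g).

Definition left_exact_functor : Prop :=
  preserves_compatible /\
  forall (X Y Z : C) (f : Mor X Y) (g : Mor Y Z),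
    left_exact_seq f g -> left_exact_seq (fmap F f) (fmap F g).

End Exactness.

(* [ius], [ils], [ish] are i^*, i_*, i^! (upper star, lower star, shriek);
   [jsh], [jus], [jls] are j_!, j^*, j_*. *)
Record recollement (k : fieldType) (A B C : extricat k) := Recollement {
  ius : addfunctor B A;
  ils : addfunctor A B;
  ish : addfunctor B A;
  jsh : addfunctor C B;
  jus : addfunctor B C;
  jls : addfunctor C B;
  ils_exact : exact_functor ils;
  jus_exact : exact_functor jus;
  ius_rexact : right_exact_functor ius;
  jsh_rexact : right_exact_functor jsh;
  ish_lexact : left_exact_functor ish;
  jls_lexact : left_exact_functor jls;
  adj_ius_ils : adjunction ius ils;
  adj_ils_ish : adjunction ils ish;
  adj_jsh_jus : adjunction jsh jus;
  adj_jus_jls : adjunction jus jls;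
  Im_ils_Ker_jus : forall X : B,
    (exists Y : A, isomorphic X (ils Y)) <-> is_zero (jus X);
  ils_ff : fully_faithful ils;
  jsh_ff : fully_faithful jsh;
  jls_ff : fully_faithful jls;
  recR4 : forall X : B, exists (Y : A) (h : Mor (jls (jus X)) (ils Y)),
    left_exact_triseq (adj_counit adj_ils_ish X) (adj_unit adj_jus_jls X) h;
  recR5 : forall X : B, exists (Y : A) (h : Mor (ils Y) (jsh (jus X))),
    right_exact_triseq h (adj_counit adj_jsh_jus X) (adj_unit adj_ius_ils X)
}.

Section Glueing.
Variables (k : fieldType) (A B C : extricat k) (rec : recollement A B C).

Definition glueU (U1 : A -> Prop) (U3 : C -> Prop) (X : B) : Prop :=
  U1 (ius rec X) /\ U3 (jus rec X).

Definition glueV (V1 : A -> Prop) (V3 : C -> Prop) (X : B) : Prop :=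
  V1 (ish rec X) /\ V3 (jus rec X).

End Glueing.

(* Main.v *)
From mathcomp Require Import all_boot all_algebra.
Require Import Defs.

(** Given X in B, take j^*X -> V -> U in C with V in V3, U in U3, apply j_! and
push out along the counit j_! j^*X -> X; this gives X -> Y -> j_! U with
j^*Y = V.  Doing the same with i_* and i^!Y -> V' -> U' gives
Y -> W -> i_* U' with W in V2, and by (ET4) the cone of X -> W is an extension
of i_* U' by j_! U, hence in U2: whenever F is left adjoint to an exact functor
G, the vanishing of E(X, GV) implies that of E(FX, V).  The other triangles of
the cotorsion pair come from pushing out a projective presentation.

The same vanishing principle for the pairs i^*, i_* and j^*, j_* gives the
inclusion of U2 in the glued class; it needs j_* to be exact, which follows
from the exactness of i^!.

Exactness of a functor does not include a natural map on E(-, -), so a functor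
is only known to preserve a pushout A -> B, A -> A' through the triangle
A -> B + A' -> G. *)

Set Implicit Arguments.
Unset Strict Implicit.
Unset Printing Implicit Defensive.

Import GRing.Theory.
Local Open Scope ring_scope.

(** * Linear categories: composition, zero objects, biproducts, subcategories *)

Section LinearCategory.
Variables (k : fieldType) (C : lincat k).

Lemma compDl (X Y Z : C) (g g' : Mor Y Z) (f : Mor X Y) :
  (g + g') \oc f = g \oc f + g' \oc f.
Proof. by have := comp_linearl 1 g g' f; rewrite !scale1r. Qed.

Lemma compDr (X Y Z : C) (g : Mor Y Z) (f f' : Mor X Y) :
  g \oc (f + f') = g \oc f + g \oc f'.
Proof. by have := comp_linearr 1 g f f'; rewrite !scale1r. Qed.

Lemma comp0m (X Y Z : C) (f : Mor X Y) : (0 : Mor Y Z) \oc f = 0.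
Proof. by apply: (addrI (0 \oc f)); rewrite -compDl !addr0. Qed.

Lemma compm0 (X Y Z : C) (g : Mor Y Z) : g \oc (0 : Mor X Y) = 0.
Proof. by apply: (addrI (g \oc 0)); rewrite -compDr !addr0. Qed.

Lemma compNl (X Y Z : C) (g : Mor Y Z) (f : Mor X Y) : (- g) \oc f = - (g \oc f).
Proof. by apply: (addrI (g \oc f)); rewrite -compDl !subrr comp0m. Qed.

Lemma compNr (X Y Z : C) (g : Mor Y Z) (f : Mor X Y) : g \oc (- f) = - (g \oc f).
Proof. by apply: (addrI (g \oc f)); rewrite -compDr !subrr compm0. Qed.

Lemma is_iso_idm (X : C) : is_iso (idm X).
Proof. by exists (idm X); rewrite comp1m. Qed.

Lemma isomorphic_sym (X Y : C) : isomorphic X Y -> isomorphic Y X.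
Proof. by case=> f [g [gf fg]]; exists g, f. Qed.

Lemma isomorphic_trans (X Y Z : C) :
  isomorphic X Y -> isomorphic Y Z -> isomorphic X Z.
Proof.
move=> [f [g [gf fg]]] [f' [g' [gf' fg']]].
exists (f' \oc f), (g \oc g'); split.
  by rewrite compA -(compA g) gf' compm1.
by rewrite compA -(compA f') fg compm1.
Qed.

Lemma iso_of_left_right_inv (X Y : C) (f : Mor X Y) (r s : Mor Y X) :
  r \oc f = idm X -> f \oc s = idm Y -> is_iso f.
Proof.
move=> rf fs; exists r; split=> //; rewrite -[r]compm1 -fs.
by rewrite !compA -(compA f r) rf compm1.
Qed.

(** Since [m] and [n] square to zero, [idm X + m] and [idm Y + n] are invertible with inverses
    [idm X - m] and [idm Y - n]; these turn [g] into a left and a right inverse of [f]. *)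
Lemma iso_of_unipotent (X Y : C) (f : Mor X Y) (g : Mor Y X)
    (m := g \oc f - idm X) (n := f \oc g - idm Y) :
  m \oc m = 0 -> n \oc n = 0 -> is_iso f.
Proof.
move=> m0 n0.
have gf : g \oc f = idm X + m by rewrite addrC subrK.
have fg : f \oc g = idm Y + n by rewrite addrC subrK.
clearbody m n; apply: (@iso_of_left_right_inv _ _ _ ((idm X - m) \oc g) (g \oc (idm Y - n))).
  by rewrite -compA gf compDl compNl comp1m compDr m0 compm1 addr0 addrK.
by rewrite compA fg compDr compNr compm1 compDl n0 comp1m addr0 addrK.
Qed.

Lemma is_zeroP (Z : C) : is_zero Z <-> idm Z = 0.
Proof.
split=> [z|z X]; first exact: (z Z).1.
by split=> f; [rewrite -[f]comp1m z comp0m | rewrite -[f]compm1 z compm0].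
Qed.

Lemma zero_into (Z X : C) : is_zero Z -> forall f : Mor X Z, f = 0.
Proof. by move=> z; exact: (z X).1. Qed.

Lemma zero_from (Z X : C) : is_zero Z -> forall f : Mor Z X, f = 0.
Proof. by move=> z; exact: (z X).2. Qed.

Lemma zero_retract (X Z : C) (s : Mor X Z) (r : Mor Z X) :
  is_zero Z -> r \oc s = idm X -> is_zero X.
Proof. by move=> z rs; apply/is_zeroP; rewrite -rs (zero_into z s) compm0. Qed.

Lemma isomorphic_zero (X Z : C) : isomorphic X Z -> is_zero Z -> is_zero X.
Proof. by move=> [f [g [gf _]]] z; exact: zero_retract z gf. Qed.

Lemma is_biprod_sym (X Y S : C) (iX : Mor X S) (iY : Mor Y S) (pX : Mor S X)
    (pY : Mor S Y) : is_biprod iX iY pX pY -> is_biprod iY iX pY pX.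
Proof. by case=> *; split; rewrite // addrC. Qed.

Lemma dsum_sym (X Y S : C) : dsum X Y S -> dsum Y X S.
Proof. by move=> [i [j [p [q b]]]]; exists j, i, q, p; exact: is_biprod_sym. Qed.

Lemma is_biprod0r (X Z : C) :
  is_zero Z -> is_biprod (idm X) (0 : Mor Z X) (idm X) (0 : Mor X Z).
Proof.
move=> z; split; rewrite ?comp1m ?compm1 ?comp0m ?addr0 //.
by move/is_zeroP: z => ->.
Qed.

Lemma iso_biprod (X Y S T : C) (b : Mor S T) : is_iso b -> dsum X Y S -> dsum X Y T.
Proof.
move=> [c [cb bc]] [iX [iY [pX [pY [h1 h2 h3 h4 h5]]]]].
exists (b \oc iX), (b \oc iY), (pX \oc c), (pY \oc c).
have E (U V : C) (p : Mor S U) (i : Mor V S) : p \oc c \oc (b \oc i) = p \oc i.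
  by rewrite compA -(compA p) cb compm1.
split; rewrite ?E //.
by rewrite -!compA -compDr !compA -compDl h5 comp1m.
Qed.

Lemma add_closure_sub (V : C -> Prop) (X : C) :
  is_additive C -> V X -> add_closure V X.
Proof.
move=> [[Z z] _] VX.
have D : dsum X Z X by exists (idm X), 0, (idm X), 0; exact: is_biprod0r.
by exists X; split; [exact: fin_sumS VX (fin_sum0 _ z) D | exists Z].
Qed.

Lemma is_subcatI (V W : C -> Prop) :
  is_subcat V -> is_subcat W -> is_subcat (fun X => V X /\ W X).
Proof.
move=> v w; split.
- by move=> X Y [a b] i; split; [exact: subcat_iso v _ _ a i | exact: subcat_iso w _ _ b i].
- by move=> Z z; split; [exact: subcat_zero v _ z | exact: subcat_zero w _ z].
- move=> X Y S [a b] [a' b'] d.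
  by split; [exact: subcat_dsum v _ _ _ a a' d | exact: subcat_dsum w _ _ _ b b' d].
- by move=> X S [a b] i; split; [exact: subcat_summand v _ _ a i | exact: subcat_summand w _ _ b i].
Qed.

End LinearCategory.

(** * Additive functors *)

Section AdditiveFunctor.
Variables (k : fieldType) (C D : lincat k) (F : addfunctor C D).

Lemma fmap0 (X Y : C) : fmap F (0 : Mor X Y) = 0.
Proof. by apply: (addrI (fmap F 0)); rewrite -fmapD !addr0. Qed.

Lemma fmap_iso (X Y : C) (f : Mor X Y) : is_iso f -> is_iso (fmap F f).
Proof. by move=> [g [gf fg]]; exists (fmap F g); rewrite -!fmapM gf fg !fmap1. Qed.

Lemma fmap_isomorphic (X Y : C) : isomorphic X Y -> isomorphic (F X) (F Y).
Proof. by move=> [f /fmap_iso i]; exists (fmap F f). Qed.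

Lemma fmap_zero (Z : C) : is_zero Z -> is_zero (F Z).
Proof. by move=> /is_zeroP z; apply/is_zeroP; rewrite -fmap1 z fmap0. Qed.

Lemma fmap_biprod (X Y S : C) (iX : Mor X S) (iY : Mor Y S) (pX : Mor S X)
    (pY : Mor S Y) : is_biprod iX iY pX pY ->
  is_biprod (fmap F iX) (fmap F iY) (fmap F pX) (fmap F pY).
Proof.
case=> h1 h2 h3 h4 h5.
by split; rewrite -!fmapM ?h1 ?h2 ?h3 ?h4 ?fmap1 ?fmap0 // -fmapD h5 fmap1.
Qed.

Lemma fmap_dsum (X Y S : C) : dsum X Y S -> dsum (F X) (F Y) (F S).
Proof.
by move=> [i [j [p [q b]]]]; do 4!eexists; exact: fmap_biprod b.
Qed.

(** Together with [is_subcatI] this shows that [glueV], an intersection of two preimages, is a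
    subcategory. *)
Lemma is_subcat_preim (V : D -> Prop) : is_subcat V -> is_subcat (fun X => V (F X)).
Proof.
move=> v; split.
- by move=> X Y a i; exact: subcat_iso v _ _ a (fmap_isomorphic i).
- by move=> Z z; exact: subcat_zero v _ (fmap_zero z).
- by move=> X Y S a b d; exact: subcat_dsum v _ _ _ a b (fmap_dsum d).
- move=> X S a [Y d]; apply: subcat_summand v _ _ a _.
  by exists (F Y); exact: fmap_dsum.
Qed.

End AdditiveFunctor.

(** * Units and counits of adjunctions with a fully faithful functor *)

Section Adjunction.
Variables (k : fieldType) (C D : lincat k).
Variables (F : addfunctor C D) (G : addfunctor D C) (adj : adjunction F G).

(** Fullness of [G] yields [u] with [fmap G u] equal to the unit at [G Y]; the triangle identities
    and faithfulness make [u] the inverse of the counit. *)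
Lemma ff_counit_iso (Y : D) : fully_faithful G -> is_iso (adj_counit adj Y).
Proof.
move=> ff; case: (ff Y (F (G Y))) => inv _ invK.
pose u := inv (adj_unit adj (G Y)).
have Gu : fmap G u = adj_unit adj (G Y) by exact: invK.
exists u; split.
  by rewrite -counit_nat Gu adj_triangleL.
apply: (bij_inj (ff Y Y)).
by rewrite fmapM Gu adj_triangleR fmap1.
Qed.

Lemma ff_unit_iso (X : C) : fully_faithful F -> is_iso (adj_unit adj X).
Proof.
move=> ff; case: (ff (G (F X)) X) => inv _ invK.
pose u := inv (adj_counit adj (F X)).
have Fu : fmap F u = adj_counit adj (F X) by exact: invK.
exists u; split; last by rewrite unit_nat Fu adj_triangleR.
apply: (bij_inj (ff X X)).
by rewrite fmapM Fu adj_triangleL fmap1.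
Qed.

Lemma fmap_counit_iso (Y : D) :
  is_iso (adj_unit adj (G Y)) -> is_iso (fmap G (adj_counit adj Y)).
Proof.
move=> [u [uv vu]]; have tr := adj_triangleR adj Y.
exists (adj_unit adj (G Y)); split=> //.
by rewrite -[fmap G _]compm1 -vu (compA (fmap G _)) tr comp1m.
Qed.

End Adjunction.

(** * Exact sequences, pushouts and cotorsion pairs in one extriangulated category *)

Section ExtriangulatedCategory.
Variables (k : fieldType) (E : extricat k).

Let R := add_realization (et2 E).

Lemma push_0 (C A A' : E) (a : Mor A A') : push a (0 : Ext C A) = 0.
Proof.
have := push_linearr (et1 E) 1 a (0 : Ext C A) 0; rewrite !scale1r addr0.
by move=> /esym/(canRL (addrK _)); rewrite subrr.
Qed.

Lemma pull_0 (C C' A : E) (c : Mor C' C) : pull c (0 : Ext C A) = 0.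
Proof.
have := pull_linearr (et1 E) 1 c (0 : Ext C A) 0; rewrite !scale1r addr0.
by move=> /esym/(canRL (addrK _)); rewrite subrr.
Qed.

Lemma push0 (C A A' : E) (d : Ext C A) : push (0 : Mor A A') d = 0.
Proof.
have := push_linearl (et1 E) 1 (0 : Mor A A') 0 d; rewrite !scale1r addr0.
by move=> /esym/(canRL (addrK _)); rewrite subrr.
Qed.

Lemma pull0 (C C' A : E) (d : Ext C A) : pull (0 : Mor C' C) d = 0.
Proof.
have := pull_linearl (et1 E) 1 (0 : Mor C' C) 0 d; rewrite !scale1r addr0.
by move=> /esym/(canRL (addrK _)); rewrite subrr.
Qed.

Lemma pullB (C C' A : E) (c c' : Mor C' C) (d : Ext C A) :
  pull (c - c') d = pull c d - pull c' d.
Proof.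
have := pull_linearl (et1 E) (-1) c' c d.
by rewrite !scaleN1r addrC => ->; rewrite addrC.
Qed.

Lemma ext_zerol (Z A : E) : is_zero Z -> forall d : Ext Z A, d = 0.
Proof. by move=> /is_zeroP z d; rewrite -[d](pull1 (et1 E)) z pull0. Qed.

Lemma ext_zeror (C Z : E) : is_zero Z -> forall d : Ext C Z, d = 0.
Proof. by move=> /is_zeroP z d; rewrite -[d](push1 (et1 E)) z push0. Qed.

(** The trivial triangles A = A -> 0 and 0 -> A = A: comparing a triangle with them turns (ET3), its
    dual and the lifting of morphisms of extensions into the exactness statements below. *)
Lemma realizes_idl (A Z : E) :
  is_zero Z -> realizes (idm A) (0 : Mor A Z) (0 : Ext Z A).
Proof. by move=> z; exact: realizes_split (et2 E) _ _ _ _ _ _ _ (is_biprod0r A z). Qed.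

Lemma realizes_idr (A Z : E) :
  is_zero Z -> realizes (0 : Mor Z A) (idm A) (0 : Ext A Z).
Proof.
move=> z; apply: (realizes_split (et2 E)).
exact: is_biprod_sym (is_biprod0r A z).
Qed.

Section Realized.
Variables (A B C : E) (x : Mor A B) (y : Mor B C) (d : Ext C A).
Hypothesis H : realizes x y d.

Lemma realizes_comp0 : y \oc x = 0.
Proof.
have [[Z z] _] := et_additive E.
have [c [<- _]] : exists c : Mor Z C,
    c \oc 0 = y \oc x /\ ext_morph (0 : Ext Z A) d (idm A) c.
  by apply: (et3 (realizes_idl A z) H).
by rewrite compm0.
Qed.

Lemma push_inflation : push x d = 0.
Proof.
have [[Z z] _] := et_additive E.
have [c [_ ->]] := et3 (a := x) (b := idm B) H (realizes_idl B z) erefl.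
by rewrite pull_0.
Qed.

Lemma pull_deflation : pull y d = 0.
Proof.
have [[Z z] _] := et_additive E.
have [a [_ <-]] := et3op (b := idm B) (c := y) (realizes_idr B z) H erefl.
by rewrite push_0.
Qed.

(** When [pull c d] vanishes, [(0, c)] is a morphism of extensions from 0 -> W = W to [d], and its
    realization is the lift. [realizes_extend] is dual. *)
Lemma realizes_lift (W : E) (c : Mor W C) :
  pull c d = 0 -> exists b : Mor W B, y \oc b = c.
Proof.
have [[Z z] _] := et_additive E.
move=> cd; have [|b [_ e]] := realizes_morph R (realizes_idr W z) H (a := 0) (c := c).
  by rewrite /ext_morph push_0 cd.
by exists b; rewrite e compm1.
Qed.

Lemma realizes_extend (W : E) (a : Mor A W) :
  push a d = 0 -> exists b : Mor B W, b \oc x = a.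
Proof.
have [[Z z] _] := et_additive E.
move=> ad; have [|b [e _]] := realizes_morph R H (realizes_idl W z) (a := a) (c := 0).
  by rewrite /ext_morph pull_0 ad.
by exists b; rewrite e comp1m.
Qed.

Lemma realizes_factor (W : E) (u : Mor B W) :
  u \oc x = 0 -> exists c : Mor C W, c \oc y = u.
Proof.
have [[Z z] _] := et_additive E.
move=> ux; have [|c [e _]] := et3 (a := (0 : Mor A Z)) (b := u) H (realizes_idr W z).
  by rewrite comp0m.
by exists c; rewrite e comp1m.
Qed.

Lemma section_ext0 (s : Mor C B) : y \oc s = idm C -> d = 0.
Proof.
by move=> ys; rewrite -[d](pull1 (et1 E)) -ys (pullM (et1 E)) pull_deflation pull_0.
Qed.

Lemma retraction_ext0 (r : Mor B A) : r \oc x = idm A -> d = 0.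
Proof.
by move=> rx; rewrite -[d](push1 (et1 E)) -rx (pushM (et1 E)) push_inflation push_0.
Qed.

(** A biproduct of [A] and [C] also realizes 0, so uniqueness of the realization carries its
    structure over to [B]. *)
Lemma ext0_dsum : d = 0 -> dsum A C B.
Proof.
move=> d0; have [_ /(_ A C) [S [iA [iC [pA [pC b]]]]]] := et_additive E.
have := realizes_split (et2 E) b; rewrite -d0 => /(realizes_uniq R)/(_ H) [f [i _ _]].
by apply: iso_biprod i _; exists iA, iC, pA, pC.
Qed.

End Realized.

(** Exactness of E(C, W) -> E(B, W) -> E(A, W) in the middle. In the diagram of (ET4)^op for S -> B
    -> C, the row W -> G -> A realizes [pull x e], which is 0, so W -> G has a retraction; pushing
    the extension of C by G along it gives [e']. *)
Lemma pull_inflation_exact (A B C W : E) (x : Mor A B) (y : Mor B C)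
    (d : Ext C A) (e : Ext B W) : realizes x y d ->
  pull x e = 0 -> exists e' : Ext C W, e = pull y e'.
Proof.
move=> H xe.
have [S [f' [f He]]] := realizes_ex R e.
have [G [d' [p [h' [h [d2 [_ [_ Hd' _ ed2]]]]]]]] := et4op He H.
have [r rd'] : exists r : Mor G W, r \oc d' = idm W.
  by apply: realizes_extend Hd' _ _ _; rewrite xe push_0.
exists (push r d2).
by rewrite -(push_pull (et1 E)) -ed2 -(pushM (et1 E)) rd' (push1 (et1 E)).
Qed.


Lemma triangle_zerol_iso (A B C : E) (x : Mor A B) (y : Mor B C) :
  triangle x y -> is_zero A -> is_iso y.
Proof.
move=> [d H] z.
have [|s ys] := realizes_lift H (c := idm C); first by rewrite (ext_zeror z d) pull_0.
have [|r ry] := realizes_factor H (u := idm B); first by rewrite (zero_from z x) compm0.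
exact: iso_of_left_right_inv ry ys.
Qed.

Lemma triangle_zeror_iso (A B C : E) (x : Mor A B) (y : Mor B C) :
  triangle x y -> is_zero C -> is_iso x.
Proof.
move=> [d H] z.
have [|r rx] := realizes_extend H (a := idm A); first by rewrite (ext_zerol z d) push_0.
have [|c cy] := realizes_factor H (u := x \oc r - idm B).
  by rewrite compDl compNl comp1m -compA rx compm1 subrr.
exists r; split=> //; apply/eqP; rewrite -subr_eq0 -cy.
by rewrite (zero_into z y) compm0.
Qed.

(** (ET3) gives [c] and [c'] in opposite directions. The defect [c' \oc c - idm C] kills [y] and
    pulls [d] back to 0, so it factors through [y] and squares to zero; likewise on the other side,
    and [iso_of_unipotent] applies. *)
Lemma cone_iso (A B C A' B' C' : E) (x : Mor A B) (y : Mor B C) (x' : Mor A' B')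
    (y' : Mor B' C') (a : Mor A A') (b : Mor B B') :
  triangle x y -> triangle x' y' -> is_iso a -> is_iso b -> b \oc x = x' \oc a ->
  exists2 c : Mor C C', is_iso c & c \oc y = y' \oc b.
Proof.
have nilp (X Y Z : E) (u : Mor X Y) (v : Mor Y Z) (d : Ext Z X) (n : Mor Z Z) :
    realizes u v d -> n \oc v = 0 -> pull n d = 0 -> n \oc n = 0.
  by move=> H nv /(realizes_lift H) [m {2}<-]; rewrite compA nv comp0m.
move=> [d H] [d' H'] [a' [a'a aa']] [b' [b'b bb']] sq.
have sq' : b' \oc x' = x \oc a'.
  by rewrite -[x']compm1 -aa' (compA x') -sq !compA b'b comp1m.
have [c [cy e]] := et3 H H' sq; have [c' [cy' e']] := et3 H' H sq'.
rewrite /ext_morph in e e'.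
exists c => //; apply: (@iso_of_unipotent _ _ _ _ _ c').
  apply: (nilp _ _ _ _ _ _ _ H).
    by rewrite compDl compNl comp1m -compA cy compA cy' -compA b'b compm1 subrr.
  by rewrite pullB (pullM (et1 E)) -e' -(push_pull (et1 E)) -e -(pushM (et1 E))
             a'a (push1 (et1 E)) (pull1 (et1 E)) subrr.
apply: (nilp _ _ _ _ _ _ _ H').
  by rewrite compDl compNl comp1m -compA cy' compA cy -compA bb' compm1 subrr.
by rewrite pullB (pullM (et1 E)) -e -(push_pull (et1 E)) -e' -(pushM (et1 E))
           aa' (push1 (et1 E)) (pull1 (et1 E)) subrr.
Qed.

Lemma triangle_comp_iso (A B C C' : E) (x : Mor A B) (y : Mor B C) (c : Mor C C') :
  triangle x y -> is_iso c -> triangle x (c \oc y).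
Proof.
move=> [d H] [c' [c'c cc']].
have [B1 [x1 [y1 H1]]] := realizes_ex R (pull c' d).
have [|b [bx yb]] := realizes_morph R H H1 (a := idm A) (c := c).
  by rewrite /ext_morph -(pullM (et1 E)) c'c (push1 (et1 E)) (pull1 (et1 E)).
have [|b' [bx' yb']] := realizes_morph R H1 H (a := idm A) (c := c').
  by rewrite /ext_morph (push1 (et1 E)).
rewrite compm1 in bx; rewrite compm1 in bx'.
exists (pull c' d); apply: (realizes_equiv R H1); exists b'; split=> //; last first.
  by rewrite -compA yb' compA cc' comp1m.
(* The comparison maps [b] and [b'] of the middle terms are inverse up to endomorphisms that vanish
   after [x] (or [x1]) and before [y] (or [y1]); such an endomorphism squares to zero. *)
have nilp (X Y Z : E) (u : Mor X Y) (v : Mor Y Z) (e : Ext Z X) (n : Mor Y Y) :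
    realizes u v e -> n \oc u = 0 -> v \oc n = 0 -> n \oc n = 0.
  by move=> K /(realizes_factor K) [m mv] vn; rewrite -{1}mv -compA vn compm0.
apply: (@iso_of_unipotent _ _ _ _ _ b).
  apply: (nilp _ _ _ _ _ _ _ H1).
    by rewrite compDl compNl comp1m -compA bx' bx subrr.
  by rewrite compDr compNr compm1 compA yb -compA yb' compA cc' comp1m subrr.
apply: (nilp _ _ _ _ _ _ _ H).
  by rewrite compDl compNl comp1m -compA bx bx' subrr.
by rewrite compDr compNr compm1 compA yb' -compA yb compA c'c comp1m subrr.
Qed.

(* The composite A -> A + A' -> B + A' of a split inflation and x + id,
   decomposed by (ET4). *)
Lemma pushout_triangles (A B C A' S : E) (x : Mor A B) (y : Mor B C) (a : Mor A A')
    (iB : Mor B S) (iA' : Mor A' S) (pB : Mor S B) (pA' : Mor S A') :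
  triangle x y -> is_biprod iB iA' pB pA' ->
  exists (G : E) (t : Mor S G) (u : Mor A' G) (v : Mor G C),
    triangle (iB \oc x + iA' \oc a) t /\ triangle u v.
Proof.
move=> [d H] bS; have [[Z z] /(_ A A') [T [jA [jA' [qA [qA' bT]]]]]] := et_additive E.
have [q1 q2 q3 q4 q5] := bT.
(* The graph of [a] is a split inflation with cone [A']: a shear of the standard biproduct
   structure. *)
have b1 : is_biprod (jA + jA' \oc a) jA' qA (qA' - a \oc qA).
  split.
  - by rewrite compDr q1 compA q3 comp0m addr0.
  - by rewrite compDl compNl -compA q2 q3 compm0 subr0.
  - exact: q3.
  - rewrite compDl compNl !compDr -!compA q1 q4 (compA qA) q3 (compA qA') q2.
    by rewrite comp1m comp0m compm0 compm1 add0r addr0 subrr.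
  - by rewrite compDl compDr compNr compA addrACA subrr addr0.
have H1 := realizes_split (et2 E) b1.
have H2 := realizes_dsum (et2 E) bT bS (is_biprod0r C z) H (realizes_idl A' z).
have [G [h [h' [d' [e [d2 [[hE _ _] [Hh He _ _]]]]]]]] := et4 H1 H2.
exists G, h', d', e; split; last by eexists; exact: He.
exists d2; rewrite compm1 in hE; suff -> : iB \oc x + iA' \oc a = h by [].
rewrite hE compDl !compDr -!(compA _ qA) -!(compA _ qA') q1 !(compA qA) !(compA qA').
by rewrite q2 q3 q4 !comp0m !compm0 comp1m compm1 addr0 add0r.
Qed.

(** An inverse of [a] makes [r] a retraction of [s], so the triangle splits with a section [u] of
    [t] satisfying [u \oc t = idm S - s \oc r]. Since [r] kills [iB] and [pA'] kills [u], the maps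
    [t \oc iB] and [pB \oc u] are mutually inverse. *)
Lemma pushout_iso (A B A' G S : E) (x : Mor A B) (a : Mor A A') (t : Mor S G)
    (iB : Mor B S) (iA' : Mor A' S) (pB : Mor S B) (pA' : Mor S A') :
  is_biprod iB iA' pB pA' -> triangle (iB \oc x + iA' \oc a) t -> is_iso a ->
  isomorphic B G.
Proof.
move=> [q1 q2 q3 q4 q5]; set s := (_ + _) => [[d H]] [a' [a'a aa']].
pose r := a' \oc pA'.
have rs : r \oc s = idm A.
  by rewrite /r /s compDr -!compA (compA pA') q4 comp0m compm0 add0r
             (compA pA') q2 comp1m.
have [|u ut] := realizes_factor H (u := idm S - s \oc r).
  by rewrite compDl comp1m compNl -compA rs compm1 subrr.
have ts := realizes_comp0 H.
have [|s' ts'] := realizes_lift H (c := idm G).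
  by rewrite (retraction_ext0 H rs) pull_0.
have tu : t \oc u = idm G.
  rewrite -[u]compm1 -ts' (compA u) ut compDl comp1m compNl compDr compNr ts'.
  by rewrite !compA ts !comp0m subr0.
have riB : r \oc iB = 0 by rewrite /r -compA q4 compm0.
have ar : a \oc r = pA' by rewrite /r compA aa' comp1m.
clearbody r.
have pu : pA' \oc u = 0.
  rewrite -ar -compA -[u]compm1 -tu (compA u) ut (compA r) compDr compm1 compNr.
  by rewrite (compA r) rs comp1m subrr comp0m compm0.
exists (t \oc iB), (pB \oc u); split.
  rewrite compA -(compA pB) ut compDr compm1 compNr compDl compNl.
  by rewrite -!compA riB !compm0 subr0.
rewrite -compA (compA iB) -[iB \oc pB](addrK (iA' \oc pA')) q5.
by rewrite compDl comp1m compNl -(compA iA') pu compm0 subr0.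
Qed.

Lemma projective_ext0 (P : E) : projective P -> forall (W : E) (d : Ext P W), d = 0.
Proof.
move=> pr W d; have [B [x [y H]]] := realizes_ex R d.
have [|s ys] := pr _ _ _ x y _ (idm P); first by exists d.
exact: (section_ext0 H ys).
Qed.

Lemma lperp1_ext (V : E -> Prop) (A B C : E) (x : Mor A B) (y : Mor B C) :
  triangle x y -> lperp1 V A -> lperp1 V C -> lperp1 V B.
Proof.
move=> [e H] pA pC W VW d.
have [|d' ->] := pull_inflation_exact (e := d) H; first exact: pA.
by rewrite (pC _ VW d') pull_0.
Qed.

Lemma lperp1_retract (V : E -> Prop) (X Y : E) (s : Mor X Y) (r : Mor Y X) :
  r \oc s = idm X -> lperp1 V Y -> lperp1 V X.
Proof.
move=> rs pY W VW d; rewrite -[d](pull1 (et1 E)) -rs (pullM (et1 E)).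
by rewrite (pY _ VW (pull r d)) pull_0.
Qed.

(** A direct sum is a split extension, and both isomorphic copies and summands are retracts. *)
Lemma lperp1_subcat (V : E -> Prop) : is_subcat (lperp1 V).
Proof.
split.
- by move=> A B pA [f [g [_ fg]]]; exact: lperp1_retract fg pA.
- by move=> Z z W _ d; exact: ext_zerol.
- move=> A B S pA pB [iA [iB [p [q b]]]].
  by apply: lperp1_ext pA pB; exists 0; exact: realizes_split (et2 E) _ _ _ _ _ _ _ b.
- by move=> A S pS [Y [iA [iB [p [q [h _ _ _ _]]]]]]; exact: lperp1_retract h pS.
Qed.

(** The triangle W -> Y -> X with [Y] in [U] and [W] in [V] splits, so [X] is a summand of [Y]. *)
Lemma cotorsion_lperp1 (U V : E -> Prop) (X : E) :
  cotorsion_pair U V -> lperp1 V X -> U X.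
Proof.
move=> cot pX; have [W [Y [x [y [UY VW [d H]]]]]] := cot_left cot X.
apply: subcat_summand (cot_subl cot) _ _ UY _.
by exists W; apply: dsum_sym; apply: ext0_dsum H _; exact: pX.
Qed.

(** Push out K -> P -> X, with [P] projective, along K -> W. The pushout lies in W -> G -> X, as
    wanted, and in P -> G -> U, which places it in [lperp1 V]. *)
Lemma lperp1_cot_left (V : E -> Prop) :
  enough_projectives E ->
  (forall X, exists (W Q : E) (x : Mor X W) (y : Mor W Q),
     [/\ lperp1 V Q, V W & triangle x y]) ->
  forall X, exists (W Q : E) (x : Mor W Q) (y : Mor Q X),
     [/\ lperp1 V Q, V W & triangle x y].
Proof.
move=> proj cotr X; have [K [P [x [y [prP xy]]]]] := proj X.
have [W [U [x' [y' [pU VW xy']]]]] := cotr K.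
have [_ /(_ P W) [S [iP [iW [pP [pW b]]]]]] := et_additive E.
(* Each use of [pushout_triangles] gives only one of these two triangles. Both [G] and [G'] are
   cones of the same map from [K] to [S], so [cone_iso] identifies them. *)
have [G [t [u [v [st uv]]]]] := pushout_triangles x' xy b.
have [G' [t' [u' [v' [st' uv']]]]] := pushout_triangles x xy' (is_biprod_sym b).
rewrite addrC in st'.
have [|c [c' [c'c _]] _] := cone_iso st st' (is_iso_idm _) (is_iso_idm _).
  by rewrite comp1m compm1.
exists W, G, u, v; split=> //.
apply: lperp1_retract c'c _; apply: lperp1_ext uv' _ pU.
by move=> Y _; exact: projective_ext0.
Qed.

End ExtriangulatedCategory.

(** * Exact functors: vanishing of extensions across an adjunction, and pushouts *)

Section ExactFunctor.
Variables (k : fieldType) (D E : extricat k).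

(** Apply [G] to an extension Y -> S -> FX. The pullback of the image along the unit of [X]
    vanishes, so the unit lifts to [m : X -> G S], whose transpose is a section of S -> FX. *)
Lemma lperp1_adj (F : addfunctor D E) (G : addfunctor E D) (V : E -> Prop) (X : D) :
  adjunction F G -> exact_functor G ->
  (forall Y, V Y -> forall d : Ext X (G Y), d = 0) -> lperp1 V (F X).
Proof.
move=> adj exG ext0 Y VY d.
have [S [x [y H]]] := realizes_ex (add_realization (et2 E)) d.
have [d' H'] : triangle (fmap G x) (fmap G y) by apply: exG; exists d.
have [|m ym] := realizes_lift H' (c := adj_unit adj X); first exact: ext0.
apply: (section_ext0 H (s := adj_counit adj S \oc fmap F m)).
by rewrite compA -counit_nat -compA -fmapM ym adj_triangleL.
Qed.

(** The image of the triangle A -> S -> G has again the shape required by [pushout_iso], over the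
    biproduct [F S]. *)
Lemma exact_pushout_iso (F : addfunctor E D) (A B A' G S : E) (x : Mor A B)
    (a : Mor A A') (t : Mor S G) (iB : Mor B S) (iA' : Mor A' S) (pB : Mor S B)
    (pA' : Mor S A') :
  exact_functor F -> is_biprod iB iA' pB pA' -> triangle (iB \oc x + iA' \oc a) t ->
  is_iso (fmap F a) -> isomorphic (F B) (F G).
Proof.
move=> exF b /exF; rewrite fmapD !fmapM => st.
exact: pushout_iso (fmap_biprod F b) st.
Qed.

End ExactFunctor.

(** * Recollements and glueing of cotorsion pairs *)

Section Recollement.
Variables (k : fieldType) (A B C : extricat k) (rec : recollement A B C).

Local Notation i_unit := (adj_unit (adj_ils_ish rec)).
Local Notation i_counit := (adj_counit (adj_ils_ish rec)).
Local Notation j_unit := (adj_unit (adj_jus_jls rec)).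
Local Notation j_counit := (adj_counit (adj_jus_jls rec)).

Lemma jus_ils_zero (Y : A) : is_zero (jus rec (ils rec Y)).
Proof.
by apply/(Im_ils_Ker_jus rec); exists Y, (idm _); exact: is_iso_idm.
Qed.

(** A map from i_* to j_* factors, by naturality of the unit, through j_* j^* i_* = 0. This applies
    to the counit i_* i^! j_* Z -> j_* Z, and a triangle identity then makes the identity of i^! j_*
    Z zero. *)
Lemma ish_jls_zero (Z : C) : is_zero (ish rec (jls rec Z)).
Proof.
have z : is_zero (jls rec (jus rec (ils rec (ish rec (jls rec Z))))).
  exact/fmap_zero/jus_ils_zero.
have e0 : i_counit (jls rec Z) = 0.
  rewrite -[i_counit _]comp1m -(adj_triangleR (adj_jus_jls rec)) -compA unit_nat.
  by rewrite (zero_into z (j_unit _)) !compm0.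
by apply/is_zeroP; rewrite -(adj_triangleR (adj_ils_ish rec)) e0 fmap0 comp0m.
Qed.

Lemma ish_ils_iso (Y : A) : isomorphic Y (ish rec (ils rec Y)).
Proof. by exists (i_unit Y); exact/ff_unit_iso/ils_ff. Qed.

Lemma ish_counit_iso (X : B) : is_iso (fmap (ish rec) (i_counit X)).
Proof. exact/fmap_counit_iso/ff_unit_iso/ils_ff. Qed.

Lemma jus_counit_jsh_iso (X : B) :
  is_iso (fmap (jus rec) (adj_counit (adj_jsh_jus rec) X)).
Proof. exact/fmap_counit_iso/ff_unit_iso/jsh_ff. Qed.

Hypothesis ish_exact : exact_functor (ish rec).

(** In (R4) the map X -> K is invertible because i_* i^! X = 0. Applying i^! to K -> j_* j^* X ->
    i_* Y, whose first two terms it kills, gives Y = 0, so K -> j_* j^* X is invertible too. *)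
Lemma jls_unit_iso (X : B) : is_zero (ish rec X) -> is_iso (j_unit X).
Proof.
move=> zX; have [Y [h [K [g1 [g2 [T1 T2 -> _]]]]]] := recR4 rec X.
have g1_iso := triangle_zerol_iso T1 (fmap_zero (ils rec) zX).
have zK : is_zero (ish rec K).
  have [g1' [_ e]] := fmap_iso (ish rec) g1_iso; exact: zero_retract zX e.
have zY : is_zero (ils rec Y).
  have [h' [_ e]] := triangle_zerol_iso (ish_exact T2) zK.
  apply: fmap_zero; apply: isomorphic_zero (ish_ils_iso Y) _.
  exact: zero_retract (ish_jls_zero _) e.
have [g1' [a1 b1]] := g1_iso; have [g2' [a2 b2]] := triangle_zeror_iso T2 zY.
exists (g1' \oc g2'); split.
  by rewrite compA -(compA g1') a2 compm1.
by rewrite compA -(compA g2) b1 compm1.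
Qed.

(* Left exactness of j_* makes j_* f an inflation; its cone K satisfies
   i^! K = 0, so that K = j_* j^* K by (R4). *)
Lemma jls_exact : exact_functor (jls rec).
Proof.
move=> V S W f g fg.
have [|K [h1 [_ [T _ _ _]]]] := (jls_lexact rec).2 V S W f g.
  (* A triangle is a left exact sequence whose compatible inflation is the identity. *)
  exists W, g, (idm W); split; rewrite ?comp1m //; last by move=> *; exact: is_iso_idm.
  have [[Z z] _] := et_additive C.
  by exists Z, 0, 0; exact: realizes_idl.
have zK : is_zero (ish rec K).
  have [h [_ e]] := triangle_zerol_iso (ish_exact T) (ish_jls_zero V).
  exact: zero_retract (ish_jls_zero S) e.
(* The counits identify the image under j^* of j_* V -> j_* S -> K with V -> S -> W, whence j^* K is
   isomorphic to [W]. *)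
have [th th_iso thE] : exists2 th : Mor (jus rec K) W,
    is_iso th & th \oc fmap (jus rec) h1 = g \oc j_counit S.
  have i (Y : C) : is_iso (j_counit Y) by exact/ff_counit_iso/jls_ff.
  exact: (cone_iso (jus_exact rec T) fg (i V) (i S) (counit_nat _ f)).
suff -> : fmap (jls rec) g = fmap (jls rec) th \oc j_unit K \oc h1.
  rewrite -compA; apply: triangle_comp_iso (fmap_iso _ th_iso).
  exact: triangle_comp_iso (jls_unit_iso zK).
rewrite -compA unit_nat compA -fmapM thE fmapM -compA.
by rewrite adj_triangleR compm1.
Qed.

Variables (U1 V1 : A -> Prop) (U3 V3 : C -> Prop).
Hypotheses (cot1 : cotorsion_pair U1 V1) (cot3 : cotorsion_pair U3 V3).

Let V2 := glueV rec V1 V3.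

(** [lperp1_adj] for i_* and i^!, where i^! is exact by hypothesis; [lperp1_jsh] does the same for
    j_! and j^*, with j^* exact in any recollement. *)
Lemma lperp1_ils (X : A) : U1 X -> lperp1 V2 (ils rec X).
Proof.
move=> UX; apply: lperp1_adj (adj_ils_ish rec) ish_exact _ => Y [VY _].
exact: cot_ext cot1 _ _ UX VY.
Qed.

Lemma lperp1_jsh (X : C) : U3 X -> lperp1 V2 (jsh rec X).
Proof.
move=> UX; apply: lperp1_adj (adj_jsh_jus rec) (jus_exact rec) _ => Y [_ VY].
exact: cot_ext cot3 _ _ UX VY.
Qed.

(** The objects i_* Y here and j_* Y in [glueV_jls] are the test objects of [V2] against which
    [lperp1_glueU] uses orthogonality. *)
Lemma glueV_ils (Y : A) : V1 Y -> V2 (ils rec Y).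
Proof.
move=> VY; split; first exact: subcat_iso (cot_subr cot1) _ _ VY (ish_ils_iso Y).
exact: subcat_zero (cot_subr cot3) _ (jus_ils_zero Y).
Qed.

Lemma glueV_jls (Y : C) : V3 Y -> V2 (jls rec Y).
Proof.
move=> VY; split; first exact: subcat_zero (cot_subr cot1) _ (ish_jls_zero Y).
apply: subcat_iso (cot_subr cot3) _ _ VY _; apply: isomorphic_sym.
by exists (j_counit Y); exact/ff_counit_iso/jls_ff.
Qed.

Lemma lperp1_glueU (X : B) : lperp1 V2 X -> glueU rec U1 U3 X.
Proof.
move=> pX; split.
  apply: (cotorsion_lperp1 cot1).
  apply: lperp1_adj (adj_ius_ils rec) (ils_exact rec) _ => Y VY.
  exact: pX (glueV_ils VY).
apply: (cotorsion_lperp1 cot3).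
apply: lperp1_adj (adj_jus_jls rec) jls_exact _ => Y VY.
exact: pX (glueV_jls VY).
Qed.

Lemma glue_cot_right (jsh_exact : exact_functor (jsh rec)) (X : B) :
  exists (W Q : B) (x : Mor X W) (y : Mor W Q), [/\ lperp1 V2 Q, V2 W & triangle x y].
Proof.
have [W3 [Q3 [x3 [y3 [UQ3 VW3 T3]]]]] := cot_right cot3 (jus rec X).
have [S [iS [iX [pS [pX b]]]]] := (et_additive B).2 (jsh rec W3) X.
have [Y [t [u [v [st uv]]]]] :=
  pushout_triangles (adj_counit (adj_jsh_jus rec) X) (jsh_exact _ _ _ _ _ T3) b.
(* j^* inverts the counit of j_! and j^*, so it sends the pushout [Y] to j^* j_! W3, a copy of
   [W3]. *)
have VY : V3 (jus rec Y).
  apply: subcat_iso (cot_subr cot3) _ _ VW3 _.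
  apply: isomorphic_trans _ (exact_pushout_iso _ b st (jus_counit_jsh_iso X)).
    by exists (adj_unit (adj_jsh_jus rec) W3); exact/ff_unit_iso/jsh_ff.
  exact: jus_exact.
have [W1 [Q1 [x1 [y1 [UQ1 VW1 T1]]]]] := cot_right cot1 (ish rec Y).
have [S' [iS' [iY [pS' [pY b']]]]] := (et_additive B).2 (ils rec W1) Y.
have [W [t' [u' [v' [st' uv']]]]] :=
  pushout_triangles (i_counit Y) (ils_exact rec T1) b'.
have VW : V2 W.
  split.
    apply: subcat_iso (cot_subr cot1) _ _ VW1 _.
    apply: isomorphic_trans (ish_ils_iso _) _.
    exact: exact_pushout_iso ish_exact b' st' (ish_counit_iso Y).
  (* The second pushout leaves j^* unchanged: j^* kills the cone i_* Q1 of Y -> W. *)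
  apply: subcat_iso (cot_subr cot3) _ _ VY _.
  exists (fmap (jus rec) u').
  exact: triangle_zeror_iso (jus_exact rec uv') (jus_ils_zero _).
have [d H] := uv; have [d' H'] := uv'.
have [Q [h [h' [m [e [d2 [[_ _ _] [Hh He _ _]]]]]]]] := et4 H H'.
exists W, Q, h, h'; split=> //; last by exists d2.
apply: lperp1_ext (lperp1_jsh UQ3) (lperp1_ils UQ1).
by eexists; exact: He.
Qed.

End Recollement.

Theorem proposition1p2 (k : fieldType) (A B C : extricat k)
    (stA : standing A) (stB : standing B) (stC : standing C)
    (rec : recollement A B C)
    (projB : enough_projectives B)
    (ish_exact : exact_functor (ish rec))
    (jsh_exact : exact_functor (jsh rec))
    (U1 V1 : A -> Prop) (U3 V3 : C -> Prop)
    (cot1 : cotorsion_pair U1 V1) (cot3 : cotorsion_pair U3 V3) :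
  let tU2 := glueU rec U1 U3 in
  let V2 := glueV rec V1 V3 in
  let U2 := lperp1 V2 in
  cotorsion_pair U2 V2 /\ (forall X : B, U2 X -> add_closure tU2 X).
Proof.
move=> tU2 V2 U2.
have cotr := glue_cot_right ish_exact cot1 cot3 jsh_exact.
split; last first.
  (* [X] itself lies in the glued class, and X = X + 0 puts it in the additive closure. *)
  move=> X pX; apply: add_closure_sub (et_additive B) _.
  exact: (lperp1_glueU ish_exact cot1 cot3 pX).
split.
- exact: lperp1_subcat.
- by apply: is_subcatI; apply: is_subcat_preim; [exact: cot_subr cot1 | exact: cot_subr cot3].
- by move=> X Y pX VY; exact: pX.
- move=> X; have [W [Q [x [y H]]]] := lperp1_cot_left projB cotr X.
  by exists W, Q, x, y.
- move=> X; have [W [Q [x [y H]]]] := cotr X.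
  by exists W, Q, x, y.
Qed.
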